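(* Let $k\geq 3$ and $n\geq 3k-6$ be positive integers, and let $G_{n,k}$ be the graph obtained as follows. Take a complete bipartite graph $K_{n,k}$ with vertex classes $U$ of order $n$ and $W$ of order $k$. Add three additional vertices $v_1,v_2,v_3$, each adjacent to exactly $n-k+2$ vertices of $U$ (and to no other vertices), in such a way that the three sets $U\setminus N(v_i)$, $i=1,2,3$, each of size $k-2$, are pairwise disjoint. Then \[\operatorname{sum}(G_{n,k})\leq n+k\quad\text{and}\quad\epsilon(G_{n,k})\geq n+2k-3.\]
   Context: For a finite simple graph $G$ and an injective labelling $f:V(G)\to\mathbb{Z}$, define $f_+(uv)=f(u)+f(v)$ for $uv\in E(G)$. The sum index $\operatorname{sum}(G)$ is the minimum, over all injective $f:V(G)\to\mathbb{Z}$, of the number of distinct values taken by $f_+$ on $E(G)$. Let $\mathbb{Z}_+$ denote the positive integers. A sum labelling of a graph $H$ is an injective function $f:V(H)\to\mathbb{Z}_+$ such that for any distinct $u,v\in V(H)$ we have $uv\in E(H)$ if and only if $f(u)+f(v)\in f(V(H))$. Given a sum labelling $f$ of $H$, a vertex $w$ is a working vertex if $f(w)=f(u)+f(v)$ for some edge $uv$ of $H$. Let $\overline{K}_r$ denote the graph with $r$ vertices and no edges, and let $G\cup\overline{K}_r$ be the disjoint union. A sum labelling of $G\cup\overline{K}_r$ is an exclusive sum labelling (for $G$) if the only working vertices are among the $r$ added vertices, i.e. no vertex of $G$ is a working vertex. The exclusive sum number $\epsilon(G)$ is the minimum $r$ for which $G\cup\overline{K}_r$ has an exclusive sum labelling.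 $N(v)$ denotes the set of neighbours of $v$. *)

(* Defs.v *)
From mathcomp Require Import all_boot all_order all_algebra.
From mathcomp Require Import boolp zify.

Set Implicit Arguments.
Unset Strict Implicit.
Unset Printing Implicit Defensive.

Record sgraph := SGraph {
  vertex :> finType;
  adj : rel vertex;
  adj_sym : symmetric adj;
  adj_irrefl : irreflexive adj }.

Arguments adj {s}.

Section SumIndex.
Variable G : sgraph.

(* Ordered pairs of adjacent vertices: each edge is listed twice, which is
   harmless since only the set of values of [f x + f y] matters. *)
Definition edge_sums (f : G -> int) : seq int :=
  [seq (f p.1 + f p.2)%R | p <- enum [pred p : G * G | adj p.1 p.2]].

Definition nb_edge_sums (f : G -> int) : nat := size (undup (edge_sums f)).

Definition sum_achievable (m : nat) : Prop :=
  exists2 f : G -> int, injective f & nb_edge_sums f = m.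

Lemma sum_achievable_ex : exists m, `[< sum_achievable m >].
Proof.
pose f (x : G) : int := Posz (enum_rank x).
exists (nb_edge_sums f); apply/asboolP; exists f => //.
by move=> x y [] /ord_inj /enum_rank_inj.
Qed.

Definition sum_index : nat := ex_minn sum_achievable_ex.

End SumIndex.

Section DisjointUnion.
Variables G H : sgraph.

Definition dunion_adj (x y : G + H) : bool :=
  match x, y with
  | inl a, inl b => adj a b
  | inr a, inr b => adj a b
  | _, _ => false
  end.

Lemma dunion_adj_sym : symmetric dunion_adj.
Proof. by move=> [a|a] [b|b] //=; rewrite adj_sym. Qed.

Lemma dunion_adj_irrefl : irreflexive dunion_adj.
Proof. by move=> [a|a] /=; rewrite adj_irrefl. Qed.

Definition dunion : sgraph := SGraph dunion_adj_sym dunion_adj_irrefl.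

End DisjointUnion.

Definition edgeless (r : nat) : sgraph :=
  @SGraph 'I_r (fun _ _ => false) (fun _ _ => erefl) (fun _ => erefl).

Definition sum_labelling (H : sgraph) (f : H -> nat) : Prop :=
  [/\ injective f, (forall v, 0 < f v) &
      forall u v : H, u != v -> (adj u v <-> exists w : H, f u + f v = f w)].

Definition working (H : sgraph) (f : H -> nat) (w : H) : Prop :=
  exists u v : H, adj u v /\ f w = f u + f v.

Section ExclusiveSumNumber.
Variable G : sgraph.

Definition exclusive_sum_labelling (r : nat)
    (f : dunion G (edgeless r) -> nat) : Prop :=
  sum_labelling f /\ forall v : G, ~ working f (inl v).

Definition exclusive_achievable (r : nat) : Prop :=
  exists f : dunion G (edgeless r) -> nat, exclusive_sum_labelling f.

(* Every graph has an exclusive sum labelling: the labels 6 * 3 ^ i + 1 are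
   1 mod 6 and have pairwise distinct two-element sums; the added vertices are
   labelled by the edge sums, which are 2 mod 6. *)
Let lab (x : G) : nat := 6 * 3 ^ enum_rank x + 1.

Let exp3_sum_inj a b c d : a < b -> c < d ->
  3 ^ a + 3 ^ b = 3 ^ c + 3 ^ d -> a = c /\ b = d.
Proof.
have lt3 x y : x < y -> 3 * 3 ^ x <= 3 ^ y.
  by move=> xy; rewrite -expnS leq_exp2l.
have p3 x : 0 < 3 ^ x by rewrite expn_gt0.
move=> ab cd E; have bd : b = d.
  have := lt3 _ _ ab; have := lt3 _ _ cd; have := p3 a; have := p3 c.
  case: (ltngtP b d) => // /lt3; lia.
split=> //; subst d; have /eqP : 3 ^ a = 3 ^ c by lia.
by rewrite eqn_exp2l // => /eqP.
Qed.

Let lab_inj : injective lab.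
Proof.
move=> x y /eqP; rewrite /lab eqn_add2r eqn_pmul2l // eqn_exp2l //.
by move=> /eqP /ord_inj /enum_rank_inj.
Qed.

Let lab_sum x y z t : x != y -> z != t -> lab x + lab y = lab z + lab t ->
  (x = z /\ y = t) \/ (x = t /\ y = z).
Proof.
have rk_neq u v : u != v :> G -> enum_rank u < enum_rank v \/ enum_rank v < enum_rank u.
  move=> uv; case: ltngtP; [by left | by right |].
  by move=> /ord_inj /enum_rank_inj E; rewrite E eqxx in uv.
have rkI (u v : G) : enum_rank u = enum_rank v :> nat -> u = v.
  by move=> /ord_inj /enum_rank_inj.
move=> /rk_neq xy /rk_neq zt; rewrite /lab => E.
by case: xy => xy; case: zt => zt;
   (case: (exp3_sum_inj xy zt); first lia) => /rkI ? /rkI ?; [left|right|right|left].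
Qed.

Lemma exclusive_achievable_ex : exists r, `[< exclusive_achievable r >].
Proof.
pose s := undup [seq lab p.1 + lab p.2 | p <- enum [pred p : G * G | adj p.1 p.2]].
have sP m : reflect (exists x y : G, adj x y /\ m = lab x + lab y) (m \in s).
  rewrite mem_undup; apply: (iffP mapP) => [[[x y]]|[x [y [xy ->]]]].
    by rewrite mem_enum => xy ->; exists x, y.
  by exists (x, y); rewrite ?mem_enum.
have s6 (i : 'I_(size s)) : exists q, nth 0 s i = 6 * q + 2.
  have /sP[x [y [_ ->]]] := mem_nth 0 (ltn_ord i).
  by exists (3 ^ enum_rank x + 3 ^ enum_rank y); rewrite /lab; lia.
have l6 x : exists q, lab x = 6 * q + 1 by exists (3 ^ enum_rank x).
pose f (x : dunion G (edgeless (size s))) : nat :=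
  match x with inl a => lab a | inr i => nth 0 s i end.
have adj_neq (x y : G) : adj x y -> x != y.
  by move=> xy; apply/eqP => E; rewrite E adj_irrefl in xy.
exists (size s); apply/asboolP; exists f; split; last first.
  move=> v [[x|i] [[y|j]]] /= [] // _.
  by have [? ->] := l6 v; have [? ->] := l6 x; have [? ->] := l6 y; lia.
split.
- move=> [x|i] [y|j] /=.
  + by move=> /lab_inj ->.
  + by have [? ->] := l6 x; have [? ->] := s6 j; lia.
  + by have [? ->] := l6 y; have [? ->] := s6 i; lia.
  + by move=> /eqP; rewrite nth_uniq ?undup_uniq // => /eqP /ord_inj ->.
- move=> [x|i] /=; first by have [? ->] := l6 x; lia.
  by have [? ->] := s6 i; lia.
- move=> [x|i] [y|j] /= ne; split=> //.
  + move=> xy; have xys : lab x + lab y \in s by apply/sP; exists x, y.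
    have lt : index (lab x + lab y) s < size s by rewrite index_mem.
    by exists (inr (Ordinal lt)) => /=; rewrite nth_index.
  + have {}ne : x != y by apply: contra ne => /eqP ->.
    case=> -[z|j] /=.
      by have [? ->] := l6 x; have [? ->] := l6 y; have [? ->] := l6 z; lia.
    have /sP[z [t [zt ->]]] := mem_nth 0 (ltn_ord j).
    case/(lab_sum ne (adj_neq _ _ zt)) => -[-> ->] //.
    by rewrite adj_sym.
  + have [? ->] := l6 x; have [? ->] := s6 j.
    by case=> -[z|l] /=; [have [? ->] := l6 z | have [? ->] := s6 l]; lia.
  + have [? ->] := l6 y; have [? ->] := s6 i.
    by case=> -[z|l] /=; [have [? ->] := l6 z | have [? ->] := s6 l]; lia.
  + have [? ->] := s6 i; have [? ->] := s6 j.
    by case=> -[z|l] /=; [have [? ->] := l6 z | have [? ->] := s6 l]; lia.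
Qed.

Definition exclusive_sum_number : nat := ex_minn exclusive_achievable_ex.

End ExclusiveSumNumber.

Section Construction.
Variables (n k : nat) (N : 'I_3 -> {set 'I_n}).

(* The three summands are U, W and {v_1, v_2, v_3}; N i is the set of
   neighbours of the i-th added vertex, a subset of U. *)
Definition Gnk_adj (x y : 'I_n + 'I_k + 'I_3) : bool :=
  match x, y with
  | inl (inl _), inl (inr _) | inl (inr _), inl (inl _) => true
  | inl (inl u), inr i | inr i, inl (inl u) => u \in N i
  | _, _ => false
  end.

Lemma Gnk_adj_sym : symmetric Gnk_adj.
Proof. by move=> [[u|w]|i] [[u'|w']|j]. Qed.

Lemma Gnk_adj_irrefl : irreflexive Gnk_adj.
Proof. by move=> [[u|w]|i]. Qed.

Definition Gnk : sgraph := SGraph Gnk_adj_sym Gnk_adj_irrefl.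

End Construction.

(* Main.v *)
(* A translate [v + U] of the labels of [U] avoids the set [S] of edge sums
   exactly on the non-neighbours of [v].  If [S] had fewer than [n + 2k - 3]
   elements, the sumset [U + W] would be so small that, after an affine change of
   variable, [U] and [W] nearly fill two intervals [0, M] and [0, N] (a case of
   Freiman's 3k-4 theorem for distinct summands).  To bound [N] one reduces modulo
   [N] and peels [U] residue class by residue class; to bound [M] one reduces
   modulo [M].  In both cases the reduced sumset is compared with a subgroup,
   namely an atom of the summand in the sense of Hamidoune.
   A number outside [U + W] then lies below [N] or above [M], and for a given [v]
   all the missing sums lie on the same side.  So two of the three vertices, with
   labels [v < v'], have their missing sums on the same side, say below.  The sums
   of [v] with the non-neighbours of [v'] are [k - 2] edge sums below the largest
   missing sum of [v'], while [U + W] has [n + k - 1] elements above it. *)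
Require Import Defs.
From mathcomp Require Import all_boot.
From mathcomp Require Import all_order all_algebra finmap perm boolp zify.

Set Implicit Arguments.
Unset Strict Implicit.
Unset Printing Implicit Defensive.
Import Order.TTheory GRing.Theory Num.Theory.

(** * Sumsets in finite abelian groups *)

Section Atoms.
Local Open Scope ring_scope.
Variables (G : finZmodType) (B : {set G}).

Definition addset (X Y : {set G}) : {set G} := [set x + y | x in X, y in Y].

Lemma addsetP (X Y : {set G}) z :
  reflect (exists x y, [/\ x \in X, y \in Y & z = x + y]) (z \in addset X Y).
Proof.
apply: (iffP imset2P) => [[x y xX yY ->]|[x [y [xX yY ->]]]]; first by exists x, y.
by exists x y.
Qed.

Lemma mem_addset (X Y : {set G}) x y : x \in X -> y \in Y -> x + y \in addset X Y.
Proof. by move=> xX yY; apply/addsetP; exists x, y. Qed.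

Lemma addsetS (X X' Y : {set G}) : X \subset X' -> addset X Y \subset addset X' Y.
Proof. by move=> sX; apply: imset2Sl. Qed.

Hypothesis B0 : 0 \in B.

Lemma sub_addset (X : {set G}) : X \subset addset X B.
Proof. by apply/subsetP=> x xX; rewrite -[x]addr0 mem_addset. Qed.

(** The size of the boundary of [X]; since [0 \in B], the truncated subtraction is exact. *)
Let bd (X : {set G}) := (#|addset X B| - #|X|)%N.

Let bdE X : (#|addset X B| = #|X| + bd X)%N.
Proof. by rewrite /bd subnKC // subset_leq_card // sub_addset. Qed.

Let bd_submod X Y : (bd (X :&: Y) + bd (X :|: Y) <= bd X + bd Y)%N.
Proof.
have U : addset (X :|: Y) B = addset X B :|: addset Y B.
  apply/setP=> z; apply/addsetP/setUP.
    by move=> [x [b [/setUP[] xX bB ->]]]; [left|right]; apply: mem_addset.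
  by case=> /addsetP[x [b [xX bB ->]]]; exists x, b; rewrite inE xX ?orbT.
have I : addset (X :&: Y) B \subset addset X B :&: addset Y B.
  by rewrite subsetI !addsetS ?subsetIl ?subsetIr.
have := subset_leq_card I; have := cardsUI (addset X B) (addset Y B).
rewrite -U !bdE; have := cardsUI X Y; lia.
Qed.

(** The candidates for an atom. The empty set and the sets whose sum with [B] is everything are
    excluded, as their boundary may be small for trivial reasons. *)
Let frag (X : {set G}) := (X != set0) && (addset X B != setT).

Let opps (X : {set G}) : {set G} := [set - x | x in X].

Let dual (X : {set G}) : {set G} := opps (~: addset X B).

(** A point outside [X + B] minus an element of [B] lies outside [X], so subtracting [B] from the
    complement of [X + B] adds at most the boundary of [X]. Negation turns [-B] back into [B]. *)
Let dual_frag X : frag X -> frag (dual X) /\ (bd (dual X) <= bd X)%N.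
Proof.
move=> /andP[/set0Pn[x0 x0X] XT].
have sub : addset (dual X) B \subset opps (~: X).
  apply/subsetP=> _ /addsetP[_ [b [/imsetP[y yX ->] bB ->]]].
  apply/imsetP; exists (y - b); last by rewrite opprB addrC.
  rewrite !inE in yX *; apply: contra yX => yX.
  by rewrite -(subrK b y) mem_addset.
have co Z : #|opps Z| = #|Z| by rewrite card_imset //; apply: oppr_inj.
have c1 := subset_leq_card sub; rewrite co in c1.
have c2 := cardsC X; have c3 := cardsC (addset X B).
have c4 : #|dual X| = #|~: addset X B| by rewrite co.
have X0 : (0 < #|X|)%N by rewrite card_gt0; apply/set0Pn; exists x0.
split; last by move: c1 c2 c3 c4; rewrite !bdE; lia.
apply/andP; split.
  rewrite -card_gt0 c4 card_gt0; apply: contra XT => /eqP E.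
  by rewrite -[addset X B]setCK E setC0.
apply/eqP=> E; move: c1; rewrite E cardsT; lia.
Qed.

(* The subgroup is an atom: a set of least boundary and, among those, of least
   size.  Two distinct meeting translates of an atom would, by submodularity,
   have a union of smaller boundary. *)
Lemma atom_subgroup (A : {set G}) : A != set0 -> addset A B != setT ->
  exists H : {set G},
    [/\ 0 \in H, {in H &, forall x y, x - y \in H}, addset H B != setT &
        (#|addset H B| + #|A| <= #|addset A B| + #|H|)%N].
Proof.
move=> A0 AT.
have [c cG] : exists c, forall Z : {set G}, (#|Z| < c)%N.
  by exists #|G|.+1 => Z; rewrite ltnS max_card.
(* A factor [c] above every cardinality makes [wt] lexicographic: first the boundary, then the
   size. *)
pose wt X := (bd X * c + #|X|)%N.
have fA : frag A by rewrite /frag A0.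
have [X fX minX] := @arg_minnP _ A frag wt fA.
have bd_min Y : frag Y -> (bd X <= bd Y)%N.
  move=> /minX; rewrite /wt => h; rewrite leqNgt; apply/negP=> lt.
  have := leq_mul lt (leqnn c); rewrite mulSn; have := cG Y; move: h.
  by move: (bd X * c)%N (bd Y * c)%N => p q; lia.
have sz_min Y : frag Y -> (bd Y <= bd X)%N -> (#|X| <= #|Y|)%N.
  move=> /minX; rewrite /wt => h le; have := leq_mul le (leqnn c); move: h.
  by move: (bd X * c)%N (bd Y * c)%N => p q; lia.
have [fD bD] := dual_frag fX.
(* Minimality of [X] against its dual. This later keeps the union of two meeting translates from
   filling the group. *)
have half : (#|X| + #|addset X B| <= #|[set: G]|)%N.
  have := sz_min _ fD bD; rewrite card_imset; last exact: oppr_inj.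
  by rewrite cardsT -(cardsC (addset X B)) addnC leq_add2l.
pose tr (g : G) (Y : {set G}) : {set G} := [set g + y | y in Y].
have ctr g Y : #|tr g Y| = #|Y| by rewrite card_imset //; apply: addrI.
have btr g : bd (tr g X) = bd X.
  rewrite /bd ctr; congr (_ - _)%N; rewrite -(ctr g (addset X B)).
  apply: eq_card => z; apply/addsetP/imsetP.
    move=> [_ [b [/imsetP[x xX ->] bB ->]]]; exists (x + b); rewrite ?addrA //.
    exact: mem_addset.
  move=> [_ /addsetP[x [b [xX bB ->]]] ->]; exists (g + x), b.
  by rewrite addrA; split=> //; apply: imset_f.
have meet g x : x \in X -> x \in tr g X -> tr g X = X.
  move=> xX xY; set Y := tr g X in xY *.
  have cI : (#|X :&: Y| <= #|X|)%N by rewrite subset_leq_card // subsetIl.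
  have [/eqP E|ltI] := eqVneq #|X :&: Y| #|X|.
    have sub : X \subset Y.
      by apply/setIidPl/eqP; rewrite eqEcard subsetIl (eqP E) leqnn.
    by apply/esym/eqP; rewrite eqEcard sub ctr leqnn.
  have fI : frag (X :&: Y).
    apply/andP; split; first by apply/set0Pn; exists x; rewrite inE xX.
    move: fX => /andP[_]; apply: contra => /eqP E.
    by rewrite -subTset -E addsetS // subsetIl.
  have bI : (bd X < bd (X :&: Y))%N.
    rewrite ltnNge; apply/negP=> /(sz_min _ fI); move: ltI; lia.
  have := bd_submod X Y; rewrite btr => sm.
  have cU := cardsUI X Y; rewrite ctr in cU.
  have pI : (0 < #|X :&: Y|)%N.
    by rewrite card_gt0; apply/set0Pn; exists x; rewrite inE xX.
  have fU : frag (X :|: Y).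
    apply/andP; split; first by apply/set0Pn; exists x; rewrite inE xX.
    apply/eqP=> E; have := bdE (X :|: Y); rewrite E.
    move: half; rewrite (bdE X); lia.
  have := bd_min _ fU; lia.
have [x0 x0X] : exists x, x \in X by move: fX => /andP[/set0Pn].
pose H := tr (- x0) X.
(* By [meet], subtracting any point of [X] gives the same set [H], which is therefore closed under
   differences. *)
have HX x : x \in X -> tr (- x) X = H.
  move=> xX; have := @meet (x0 - x) x0 x0X.
  rewrite -{1}[x0](subrK x) imset_f // => /(_ isT) E.
  rewrite /H -{2}E; apply/setP=> z; apply/imsetP/imsetP.
    move=> [y yX ->]; exists (x0 - x + y); first exact: imset_f.
    by rewrite !addrA addNr add0r.
  by move=> [_ /imsetP[y yX ->] ->]; exists y; rewrite // !addrA addNr add0r.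
exists H; split.
- by apply/imsetP; exists x0; rewrite ?addNr.
- move=> _ _ /imsetP[x xX ->] /imsetP[y yX ->].
  rewrite opprD opprK addrACA addNr add0r addrC -(HX y yX).
  exact: imset_f.
- move: fX => /andP[_]; apply: contra => /eqP E.
  rewrite -subTset; apply/subsetP=> z _.
  have /addsetP : z - x0 \in addset H B by rewrite E in_setT.
  case=> [_ [b [/imsetP[x xX ->] bB Ez]]].
  by rewrite -(subrK x0 z) Ez addrAC [- x0 + x]addrC subrK; apply: mem_addset.
- rewrite (bdE H) (bdE A) btr ctr; have := bd_min _ fA; lia.
Qed.

(** The subgroup [H] is proper, so it omits some [b \in B], and [H + B] contains the disjoint sets
    [H] and [H + b]. Hence the boundary of [H] is at least half of [|H + B|], so at least half of
    [|B|], and that of [A] is no smaller. *)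
Lemma olson_bound (A : {set G}) :
  (forall H : {set G}, 0 \in H -> {in H &, forall x y, x - y \in H} ->
     B \subset H -> H = setT) ->
  A != set0 -> addset A B != setT ->
  (2 * #|A| + #|B| <= 2 * #|addset A B|)%N.
Proof.
move=> gen A0 AT; have [H [H0 Hsub HT le]] := atom_subgroup A0 AT.
have [b bB bH] : exists2 b, b \in B & b \notin H.
  apply/subsetPn; apply: contraNN HT => /(gen H H0 Hsub) ->.
  by rewrite -subTset sub_addset.
have HD x y : x \in H -> y \in H -> x + y \in H.
  by move=> xH yH; rewrite -[y]opprK -[- y]add0r !Hsub.
have c1 : (#|B| <= #|addset H B|)%N.
  by rewrite subset_leq_card //; apply/subsetP=> x xB; rewrite -[x]add0r mem_addset.
have c2 : (2 * #|H| <= #|addset H B|)%N.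
  pose Hb : {set G} := [set x + b | x in H].
  have cb : #|Hb| = #|H| by rewrite card_imset //; apply: addIr.
  have dis : H :&: Hb = set0.
    apply/setP=> z; rewrite !inE; apply/negP=> /andP[zH /imsetP[x xH E]].
    by move: bH; rewrite -(addrK x b) addrC [b + x]addrC -E addrC Hsub.
  have := cardsUI H Hb; rewrite dis cards0 cb addn0 mul2n -addnn => <-.
  rewrite subset_leq_card // subUset sub_addset.
  by apply/subsetP=> _ /imsetP[x xH ->]; apply: mem_addset.
lia.
Qed.

End Atoms.

(** * Sumsets of integers *)

Section IntegerSumsets.
Local Open Scope fset_scope.
Local Open Scope ring_scope.
Implicit Types (A B P S : {fset int}) (x y z : int).

Definition sumset A B : {fset int} := [fset a + b | a in A, b in B].

Lemma sumsetP A B z :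
  reflect (exists a b, [/\ a \in A, b \in B & z = a + b]) (z \in sumset A B).
Proof.
apply: (iffP idP) => [/imfset2P[a /= aA [b /= bB ->]]|[a [b [aA bB ->]]]].
  by exists a, b.
by apply/imfset2P; exists a => //; exists b.
Qed.

Lemma mem_sumset A B a b : a \in A -> b \in B -> a + b \in sumset A B.
Proof. by move=> aA bB; apply/sumsetP; exists a, b. Qed.

Lemma card_fset_sub A B : {subset A <= B} -> (#|` A| <= #|` B|)%N.
Proof. by move=> sAB; apply/fsubset_leq_card/fsubsetP. Qed.

Lemma card_fset_disj A B S : {subset A <= S} -> {subset B <= S} ->
  (forall x, x \in A -> x \in B -> False) -> (#|` A| + #|` B| <= #|` S|)%N.
Proof.
move=> AS BS dis; rewrite -cardfsUI.
have -> : A `&` B = fset0.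
  by apply/fsetP=> x; rewrite in_fsetI; apply/negP=> /andP[] /dis h /h.
rewrite cardfs0 addn0; apply: card_fset_sub => x.
by rewrite in_fsetU => /orP[/AS|/BS].
Qed.

Lemma card_fset_itv A x (n : nat) :
  {in A, forall y, x <= y < x + n%:Z} -> (#|` A| <= n)%N.
Proof.
move=> Ax; rewrite -[leqRHS](size_iota 0).
have -> : #|` A| = size [seq `|y - x|%N | y <- A] by rewrite size_map.
apply: uniq_leq_size.
  rewrite map_inj_in_uniq ?fset_uniq // => y z /Ax hy /Ax hz; lia.
by move=> _ /mapP[y /Ax hy ->]; rewrite mem_iota; lia.
Qed.

(** Pigeonhole, mostly applied to one summand and a reflection [z - B] of the other: these are
    disjoint when [z] is not a sum. *)
Lemma card_fset_itv_disj A B x (n : nat) :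
  {in A, forall y, x <= y < x + n%:Z} -> {in B, forall y, x <= y < x + n%:Z} ->
  (forall y, y \in A -> y \in B -> False) -> (#|` A| + #|` B| <= n)%N.
Proof.
move=> Ax Bx dis; apply: leq_trans (_ : #|` A `|` B| <= n)%N.
  by apply: card_fset_disj dis => y yA; rewrite in_fsetU yA ?orbT.
by apply: (@card_fset_itv _ x) => y; rewrite in_fsetU => /orP[/Ax|/Bx].
Qed.

Lemma card_fset_filter A (p : pred int) :
  (#|` [fset x in A | p x]| + #|` [fset x in A | ~~ p x]| = #|` A|)%N.
Proof.
rewrite -cardfsUI (_ : _ `&` _ = fset0) ?cardfs0 ?addn0; last first.
  by apply/fsetP=> x; rewrite !inE /=; case: (p x); rewrite ?andbF.
by congr #|` _|; apply/fsetP=> x; rewrite !inE /=; case: (p x); rewrite ?andbT ?andbF ?orbF.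
Qed.

Lemma fset_max A : A != fset0 -> exists2 x, x \in A & {in A, forall y, y <= x}.
Proof.
have H : forall s : seq int, s != [::] -> exists2 x, x \in s & {in s, forall y, y <= x}.
  elim=> // a [|b s] IH _.
    by exists a; rewrite ?mem_head // => y; rewrite inE => /eqP ->.
  have [//|x xs xmax] := IH; have [le|lt] := leP a x.
    exists x; first by rewrite inE xs orbT.
    by move=> y; rewrite inE => /orP[/eqP->|/xmax].
  exists a; first exact: mem_head.
  by move=> y; rewrite inE => /orP[/eqP->//|/xmax le]; apply: le_trans le (ltW lt).
move=> A0; case: (H A) => [|x xA xmax]; last by exists x.
by apply: contraNneq A0 => E; rewrite -cardfs_eq0 /= E.
Qed.

Lemma dvdz_distC d x y : (d %| x - y)%Z = (d %| y - x)%Z.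
Proof. by rewrite !dvdzE -opprB abszN. Qed.

(** * Residue classes of sets of integers *)

Section Residues.
Variable m : nat.
Hypothesis m1 : (1 < m)%N.

Definition resid A : {set 'Z_m} := [set c | has (fun a => a%:~R == c) A].

Lemma residP A c : reflect (exists2 a, a \in A & c = a%:~R) (c \in resid A).
Proof.
rewrite inE; apply: (iffP hasP) => -[a aA].
  by move=> /eqP<-; exists a.
by move=> ->; exists a.
Qed.

Lemma mem_resid A a : a \in A -> a%:~R \in resid A.
Proof. by move=> aA; apply/residP; exists a. Qed.

Lemma card_Zm : #|'Z_m| = m.
Proof. by rewrite card_ord Zp_cast. Qed.

Lemma intr_Zm_eq0 x : ((x%:~R : 'Z_m) == 0) = (m %| x)%Z.
Proof.
have H (n : nat) : ((n%:R : 'Z_m) == 0) = (m %| n)%N.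
  by rewrite -val_eqE /= val_Zp_nat.
by case: x => n; rewrite ?NegzE ?rmorphN /= ?oppr_eq0 -pmulrn H dvdzE ?abszN.
Qed.

Lemma eq_intr_Zm x y : ((x%:~R : 'Z_m) == y%:~R) = (m %| x - y)%Z.
Proof. by rewrite -subr_eq0 -rmorphB intr_Zm_eq0. Qed.

Lemma Zm_intr (c : 'Z_m) : exists x : int, c = x%:~R.
Proof. by exists (Posz (val c)); rewrite -pmulrn natr_Zp. Qed.

Lemma residS A P : {subset A <= P} -> resid A \subset resid P.
Proof. by move=> AP; apply/subsetP=> _ /residP[a /AP aP ->]; apply: mem_resid. Qed.

Lemma resid_sumset A B : resid (sumset A B) = addset (resid A) (resid B).
Proof.
apply/setP=> c; apply/residP/addsetP.
  move=> [_ /sumsetP[a [b [aA bB ->]]] ->]; exists a%:~R, b%:~R.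
  by rewrite !mem_resid // rmorphD.
move=> [_ [_ [/residP[a aA ->] /residP[b bB ->] ->]]]; exists (a + b).
  exact: mem_sumset.
by rewrite rmorphD.
Qed.

Lemma card_resid_inj A :
  {in A &, forall x y, (m %| x - y)%Z -> x = y} -> #|resid A| = #|` A|.
Proof.
move=> inj; rewrite cardE.
have -> : #|` A| = size [seq (a%:~R : 'Z_m) | a <- A] by rewrite size_map.
apply/perm_size/uniq_perm; first exact: enum_uniq.
  rewrite map_inj_in_uniq ?fset_uniq // => x y xA yA /eqP.
  by rewrite eq_intr_Zm => /inj; apply.
move=> c; rewrite mem_enum; apply/residP/mapP => -[a aA E]; by exists a.
Qed.

Definition class_max A : {fset int} :=
  [fset a in A | all (fun b => (m %| a - b)%Z ==> (b <= a)) A].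

Lemma class_maxP A a :
  reflect (a \in A /\ {in A, forall b, (m %| a - b)%Z -> b <= a}) (a \in class_max A).
Proof.
rewrite !inE /=; apply: (iffP andP) => -[aA].
  by move=> /allP h; split=> // b /h /implyP.
by move=> h; split=> //; apply/allP=> b /h ?; apply/implyP.
Qed.

Lemma class_max_ex A a : a \in A -> exists2 x, x \in class_max A & (m %| a - x)%Z.
Proof.
move=> aA; pose C := [fset x in A | (m %| a - x)%Z].
have [|x] := @fset_max C.
  by apply/fset0Pn; exists a; rewrite !inE aA subrr dvdz0.
rewrite !inE => /andP[/= xA ax] xmax; exists x => //; apply/class_maxP; split=> // b bA xb.
by apply: xmax; rewrite !inE bA /= -[a - b](subrKA x) rpredD.
Qed.

Lemma resid_class_max A : resid (class_max A) = resid A.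
Proof.
apply/eqP; rewrite eqEsubset residS /=; last by move=> x /class_maxP[].
apply/subsetP=> _ /residP[a aA ->]; have [x xM ax] := class_max_ex aA.
by apply/residP; exists x => //; apply/eqP; rewrite eq_intr_Zm.
Qed.

Lemma card_class_max A : #|` class_max A| = #|resid A|.
Proof.
rewrite -resid_class_max card_resid_inj // => x y /class_maxP[xA xm] /class_maxP[yA ym] xy.
by apply/eqP; rewrite eq_le xm // ym // dvdz_distC.
Qed.

(* In each residue class the largest element of [A + B] is not in [A + x]. *)
Lemma card_sumset_resid A B x : x \in B -> x + m%:Z \in B ->
  (#|` A| + #|resid (sumset A B)| <= #|` sumset A B|)%N.
Proof.
move=> xB xmB; have AS a : a \in A -> a + x \in sumset A B by move=> aA; apply: mem_sumset.
pose T := class_max (sumset A B); rewrite -card_class_max -/T.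
have -> : #|` A| = #|` [fset a + x | a in A]|.
  by rewrite card_in_imfset // => a b _ _ /addIr.
apply: card_fset_disj.
- by move=> _ /imfsetP[a /= aA ->]; apply: AS.
- by move=> z /class_maxP[].
- move=> _ /imfsetP[a /= aA ->] /class_maxP[_ /(_ (a + (x + m%:Z)))].
  rewrite mem_sumset // => /(_ isT); rewrite (_ : _ - _ = - m%:Z); last by lia.
  by rewrite dvdzE abszN => /(_ (dvdnn m)); lia.
Qed.

(** A sum [a + b] with [a] not the largest of its class is exceeded by a congruent sum, so it is not
    the largest of its own class. *)
Lemma card_sumset_peel A B :
  (#|` sumset (A `\` class_max A) B| + #|resid (sumset A B)| <= #|` sumset A B|)%N.
Proof.
rewrite -card_class_max; apply: card_fset_disj.
- by move=> _ /sumsetP[a [b [/fsetDP[aA _] bB ->]]]; apply: mem_sumset.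
- by move=> z /class_maxP[].
- move=> _ /sumsetP[a [b [/fsetDP[aA aM] bB ->]]] /class_maxP[_ h].
  have [x /class_maxP[xA xm] ax] := class_max_ex aA.
  have lt : a < x.
    rewrite lt_neqAle xm // 1?dvdz_distC // andbT.
    by apply: contraNneq aM => ->; apply/class_maxP.
  have := h _ (mem_sumset xA bB); rewrite (_ : _ - _ = a - x); last by lia.
  by move=> /(_ ax); lia.
Qed.

Lemma card_peel A : (#|` A `\` class_max A| + #|resid A| = #|` A|)%N.
Proof.
rewrite -card_class_max -[RHS](cardfsID (class_max A)) addnC; congr (_ + _)%N.
by congr #|` _|; apply/esym/fsetIidPr/fsubsetP=> x /class_maxP[].
Qed.

End Residues.

Lemma dvdz_dist_small (m : nat) x y z : (m %| x - y)%Z ->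
  z <= x < z + m%:Z -> z <= y < z + m%:Z -> x = y.
Proof.
move=> /dvdzP[q E] hx hy.
have [] : q = 0 \/ (1 <= q \/ q <= -1) by lia.
  by move=> q0; move: E; rewrite q0; lia.
by case; nia.
Qed.

Lemma dvdz_dist_divn (g a b : nat) :
  (g %| a%:Z - b%:Z)%Z -> (a %/ g = b %/ g)%N -> a = b.
Proof.
rewrite -eqz_mod_dvd !modz_nat eqz_nat => /eqP mod_eq div_eq.
by rewrite (divn_eq a g) mod_eq div_eq -divn_eq.
Qed.

(** * Bounds on the spans of the two summands *)

Section Spans.
Variable m : nat.
Hypothesis m1 : (1 < m)%N.

(** Take for [g] the least positive integer whose residue lies in [H] and divide with remainder. *)
Lemma Zm_subgroup (H : {set 'Z_m}) :
  0 \in H -> {in H &, forall c d, c - d \in H} ->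
  exists g : nat, [/\ (0 < g)%N, (g %| m)%N & forall x, (x%:~R \in H) = (g %| x)%Z].
Proof.
move=> H0 Hsub.
have HN c : c \in H -> - c \in H by move=> cH; rewrite -sub0r Hsub.
have HD c d : c \in H -> d \in H -> c + d \in H.
  by move=> cH dH; rewrite -[d]opprK Hsub // HN.
have Hn c (n : nat) : c \in H -> c *+ n \in H.
  by move=> cH; elim: n => [|n IH]; rewrite ?mulr0n // mulrS HD.
have Hz c z : c \in H -> c *~ z \in H.
  by move=> cH; case: z => n; rewrite ?NegzE ?mulrNz ?HN // -pmulrn Hn.
have exg : exists g, (0 < g)%N && ((g%:Z)%:~R \in H).
  by exists m; rewrite (ltn_trans _ m1) //= (_ : _%:~R = 0) // -pmulrn pchar_Zp.
case: (ex_minnP exg) => g /andP[g0 gH] ming.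
have key x : (x%:~R \in H) = (g %| x)%Z.
  apply/idP/idP => [xH|/dvdzP[q ->]]; last first.
    by rewrite mulrC mulrzA Hz.
  have rH : ((x %% g)%Z)%:~R \in H.
    rewrite (_ : (x %% g)%Z = x - (x %/ g)%Z * g); last first.
      by rewrite {2}(divz_eq x g) addrC addKr.
    by rewrite rmorphB /= Hsub // mulrC mulrzA Hz.
  apply/dvdz_mod0P; have r0 : 0 <= (x %% g)%Z by rewrite modz_ge0; lia.
  have rg : (x %% g)%Z < g by rewrite ltz_pmod; lia.
  case: (x %% g)%Z r0 rg rH => [[|r]|] // _ rg rH.
  by have := ming r.+1; rewrite rH => /(_ isT); lia.
exists g; split => //.
by have := key m; rewrite -pmulrn pchar_Zp // H0 dvdzE => /esym.
Qed.

(** Turns coprimality of the elements of [B] into the generation hypothesis of [olson_bound]. *)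
Lemma resid_generates B (H : {set 'Z_m}) :
  (forall g : nat, {in B, forall b, (g %| b)%Z} -> g = 1%N) ->
  0 \in H -> {in H &, forall c d, c - d \in H} -> resid m B \subset H -> H = setT.
Proof.
move=> gcdB H0 Hsub BH; have [g [g0 _ gP]] := Zm_subgroup H0 Hsub.
have g1 : g = 1%N.
  by apply: gcdB => b bB; rewrite -gP (subsetP BH) // mem_resid.
apply/eqP; rewrite -subTset; apply/subsetP=> c _; have [x ->] := Zm_intr c.
by rewrite gP g1 dvdzE dvd1n.
Qed.

End Spans.

(* Peeling off the largest element of every residue class of [A] modulo [N]
   decreases [|A + B| - |A|] by the boundary of the residue set of [A]. *)
Lemma span_le (A B : {fset int}) (t N : nat) :
  (0 < t)%N -> #|` B| = t.+2 -> (3 * t <= #|` A|)%N ->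
  0 \in B -> N%:Z \in B -> {in B, forall b, 0 <= b <= N%:Z} ->
  (forall g : nat, {in B, forall b, (g %| b)%Z} -> g = 1%N) ->
  (#|` sumset A B| <= #|` A| + 2 * t)%N ->
  (#|` A| + N <= #|` sumset A B|)%N.
Proof.
move=> t0 cB cA B0 BN Bint gcdB small.
have N1 : (1 < N)%N.
  have : (#|` B| <= N.+1)%N by apply: (@card_fset_itv _ 0) => b /Bint; lia.
  by rewrite cB; lia.
have sR := card_sumset_resid N1 A B0 (_ : 0 + N%:Z \in B); rewrite add0r in sR.
have {}sR := sR BN.
(* If [A + B] meets every class modulo [N], then [sR] is the claim; the other case is refuted
   below. *)
have [full|part] := eqVneq (resid N (sumset A B)) setT.
  by move: sR; rewrite full cardsT card_Zm.
(* Modulo [N], only the elements 0 and [N] of [B] coincide. *)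
have cBN : (t < #|resid N B|)%N.
  have c1 : #|resid N (B `\ N%:Z)| = #|` B `\ N%:Z|.
    rewrite card_resid_inj // => x y.
    rewrite !inE => /andP[xN /Bint hx] /andP[yN /Bint hy] d.
    by apply: (dvdz_dist_small (z := 0) d); lia.
  have c2 := cardfsD1 N%:Z B; rewrite BN cB in c2.
  have := subset_leq_card (residS N (_ : {subset B `\ N%:Z <= B})).
  rewrite c1 => h; have {}h : (#|` B `\ N%:Z| <= #|resid N B|)%N.
    by apply: h => x; rewrite !inE => /andP[].
  by have [->] : t.+2 = #|` B `\ N%:Z|.+1 := c2.
have R0 : 0 \in resid N B by apply/residP; exists 0.
have ols C : C != fset0 -> {subset C <= A} ->
    (2 * #|resid N C| + t.+1 <= 2 * #|resid N (sumset C B)|)%N.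
  move=> C0 CA.
  have := @olson_bound _ (resid N B) R0 (resid N C) (fun H => resid_generates N1 gcdB) _.
  rewrite -resid_sumset => h; apply: leq_trans (h _ _); first by rewrite leq_add2l.
    by have [c cC] := fset0Pn _ C0; apply/set0Pn; exists c%:~R; apply: mem_resid.
  apply: contraNneq part => E; rewrite -subTset -E residS //.
  move=> _ /sumsetP[c [b [cC bB ->]]].
  by apply: mem_sumset => //; apply: CA.
(* Let [e = |A + B| - |A|], and let layer [i], counted from 0, have [r_i] residues. Each peel lowers
   the excess by at least [(t+1)/2], so [e >= r_i + (i+1)(t+1)/2] for a nonempty layer. If at most
   three layers exhaust [A], averaging these bounds with [3t <= |A|] gives [e > 2t]; a nonempty
   fourth layer gives [e >= 1 + 2(t+1)]. *)
pose A1 := A `\` class_max N A; pose A2 := A1 `\` class_max N A1.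
pose A3 := A2 `\` class_max N A2.
have s1 : {subset A1 <= A} by move=> x /fsetDP[].
have s2 : {subset A2 <= A} by move=> x /fsetDP[/s1].
have s3 : {subset A3 <= A} by move=> x /fsetDP[/s2].
have p0 := card_sumset_peel N1 A B; have q0 := card_peel N1 A.
have p1 := card_sumset_peel N1 A1 B; have q1 := card_peel N1 A1.
have p2 := card_sumset_peel N1 A2 B; have q2 := card_peel N1 A2.
rewrite -/A1 in p0 q0; rewrite -/A2 in p1 q1; rewrite -/A3 in p2 q2.
have r1 := card_sumset_resid N1 A1 B0 (_ : 0 + N%:Z \in B); rewrite add0r in r1.
have r2 := card_sumset_resid N1 A2 B0 (_ : 0 + N%:Z \in B); rewrite add0r in r2.
have r3 := card_sumset_resid N1 A3 B0 (_ : 0 + N%:Z \in B); rewrite add0r in r3.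
have {}r1 := r1 BN; have {}r2 := r2 BN; have {}r3 := r3 BN.
have o0 : (2 * #|resid N A| + t.+1 <= 2 * #|resid N (sumset A B)|)%N.
  by apply: ols => //; rewrite -cardfs_gt0; lia.
have [E1|n1] := eqVneq A1 fset0; first by move: q0; rewrite E1 cardfs0; lia.
have o1 := ols _ n1 s1.
have [E2|n2] := eqVneq A2 fset0; first by move: q1; rewrite E2 cardfs0; lia.
have o2 := ols _ n2 s2.
have [E3|n3] := eqVneq A3 fset0; first by move: q2; rewrite E3 cardfs0; lia.
have o3 := ols _ n3 s3.
have : (0 < #|resid N A3|)%N.
  by have [c cC] := fset0Pn _ n3; apply/card_gt0P; exists c%:~R; apply: mem_resid.
lia.
Qed.

(* Here [h] is the order of the subgroup generated by [g] modulo [M], and [s] the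
   number of residues modulo [g] met by [B]. *)
Lemma span_arith (n t N M g h s q : nat) :
  (0 < t)%N -> (3 * t <= n)%N -> (N <= 2 * t)%N -> (n + t < M + 2)%N ->
  (M <= g * h)%N -> (1 < s)%N -> (0 < h)%N -> (q * g <= N)%N ->
  (t.+2 <= s * q.+1)%N -> (s * h + 1 <= t + h)%N -> False.
Proof.
move=> t0 nt Nt nM Mgh s1 h0 qg ts sh.
have [s' Es] : exists s', s = s'.+2 by exists (s - 2)%N; lia.
have [q0|q0] := posnP q; first by nia.
have [q' Eq] : exists q', q = q'.+1 by exists q.-1; lia.
(* The product of these bounds is [(4t-1)(s-1)q <= 2t(t-1)], so [2(s-1)q < t]. Then
   [s(q+1) <= 2(s-1)q + 2 < t + 2], a contradiction. *)
have b1 : (s'.+1 * h <= t - 1)%N by nia.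
have b2 : (4 * t - 1 <= g * h)%N by lia.
have b3 : ((4 * t - 1) * s'.+1 * q <= (2 * t) * (t - 1))%N.
  apply: leq_trans (_ : (q * g) * (s'.+1 * h) <= _)%N; last by apply: leq_mul; lia.
  rewrite [leqRHS](_ : _ = (g * h) * s'.+1 * q)%N; last by lia.
  by rewrite !leq_mul2r b2 !orbT.
have b4 : (2 * (s'.+1 * q) < t)%N.
  rewrite ltnNge; apply/negP=> le; have := leq_mul (leqnn (4 * t - 1)%N) le.
  move: b3; rewrite -mulnA; move: (s'.+1 * q)%N => p; nia.
nia.
Qed.

(** The last count of [length_le]: [x] is [s * h], while [r], [u] and [a] are the sizes of [A]
    modulo [M], of [A + B] modulo [M], and of [A]. *)
Lemma boundary_arith (t x h r u a : nat) : (x + r <= u + h)%N ->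
  (t.+2 + u <= a + 2 * t)%N -> (a <= r + 1)%N -> (x + 1 <= t + h)%N.
Proof. lia. Qed.

(** If [M] were larger, [A + B] would miss a class modulo [M], by [card_sumset_resid] with the
    summands exchanged. The atom of [B] modulo [M] is then generated by a divisor [g > 1] of [M],
    and [B] meets so few classes modulo [g] that [span_arith] applies. *)
Lemma length_le (A B : {fset int}) (t N M : nat) :
  (0 < t)%N -> #|` B| = t.+2 -> (3 * t <= #|` A|)%N -> (N <= 2 * t)%N ->
  0 \in A -> M%:Z \in A -> {in A, forall a, 0 <= a <= M%:Z} ->
  0 \in B -> {in B, forall b, 0 <= b <= N%:Z} ->
  (forall g : nat, {in B, forall b, (g %| b)%Z} -> g = 1%N) ->
  (#|` sumset A B| <= #|` A| + 2 * t)%N ->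
  (M + 2 <= #|` A| + t)%N.
Proof.
move=> t0 cB cA N2 A0 AM Aint B0 Bint gcdB small; rewrite leqNgt; apply/negP=> big.
have M1 : (1 < M)%N by lia.
have NM : (N < M)%N by lia.
have AB_BA : sumset B A = sumset A B.
  apply/fsetP=> z; apply/sumsetP/sumsetP => -[a [b [aA bB ->]]];
    by exists b, a; rewrite addrC.
have sR := card_sumset_resid M1 B A0 (_ : 0 + M%:Z \in A); rewrite add0r AB_BA in sR.
have {}sR := sR AM.
have cAM : (#|` A| <= #|resid M A| + 1)%N.
  have c1 : #|resid M (A `\ M%:Z)| = #|` A `\ M%:Z|.
    rewrite card_resid_inj // => x y.
    rewrite !inE => /andP[xN /Aint hx] /andP[yN /Aint hy] d.
    by apply: (dvdz_dist_small (z := 0) d); lia.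
  have c2 := cardfsD1 M%:Z A; rewrite AM in c2.
  have := subset_leq_card (residS M (_ : {subset A `\ M%:Z <= A})).
  rewrite c1 => h; rewrite c2 addnC leq_add2r h // => x.
  by rewrite !inE => /andP[].
have R0 : 0 \in resid M B by apply/residP; exists 0.
have RA : resid M A != set0 by apply/set0Pn; exists 0; apply/residP; exists 0.
have part : addset (resid M A) (resid M B) != setT.
  rewrite -resid_sumset; apply/eqP=> E; move: sR; rewrite E cardsT card_Zm // cB; lia.
have [H [H0 Hsub HT le]] := atom_subgroup R0 RA part.
have [g [g0 gm gP]] := Zm_subgroup M1 H0 Hsub.
have g1 : (1 < g)%N.
  rewrite ltn_neqAle g0 andbT; apply: contra HT => /eqP E.
  rewrite -subTset; apply: subset_trans (sub_addset R0 H).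
  by apply/subsetP=> c _; have [x ->] := Zm_intr c; rewrite gP -E dvdzE dvd1n.
have cH : (M <= g * #|H|)%N.
  have : (M %/ g <= #|H|)%N.
    rewrite -[(M %/ g)%N]card_ord.
    pose f (i : 'I_(M %/ g)) : 'Z_M := ((g * i)%N%:Z)%:~R.
    have fI : injective f.
      move=> i j /eqP; rewrite eq_intr_Zm // => E; apply/val_inj => /=.
      have lt (l : 'I_(M %/ g)) : (g * l < M)%N.
        by rewrite -{2}(divnK gm) mulnC ltn_pmul2r.
      have [E'] : (g * i)%N%:Z = (g * j)%N.
        by apply: (dvdz_dist_small (z := 0) E); rewrite add0r ltz_nat lt.
      by apply/eqP; rewrite -(eqn_pmul2l g0) E'.
    rewrite -(card_imset _ fI) subset_leq_card //; apply/subsetP=> _ /imsetP[i _ ->].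
    by rewrite gP dvdzE dvdn_mulr.
  by move=> le'; have := leq_mul (leqnn g) le'; rewrite mulnC divnK.
have h0 : (0 < #|H|)%N by apply/card_gt0P; exists 0.
pose s := #|resid g B|.
have csH : (s * #|H| <= #|addset H (resid M B)|)%N.
  (* A representative in [B] of each class; it matters only on [resid g B], where the default 0 of
     [nth] is not reached. Distinct classes modulo [g] give distinct cosets of [H]. *)
  pose rep (c : 'Z_g) : int := nth 0 B (find (fun b => b%:~R == c) B).
  have repP c : c \in resid g B -> rep c \in B /\ (rep c)%:~R = c.
    rewrite inE => hc; split; first by rewrite mem_nth // -has_find.
    by apply/eqP/(nth_find 0 hc).
  pose f (u : 'Z_g * 'Z_M) : 'Z_M := u.2 + (rep u.1)%:~R.
  rewrite /s -cardsX -(@card_in_imset _ _ f); last first.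
    move=> [c x] [d y]; rewrite !in_setX /= => /andP[cB' xH] /andP[dB' yH].
    rewrite /f /= => E.
    have [rc Ec] := repP _ cB'; have [rd Ed] := repP _ dB'.
    have : ((rep c - rep d)%:~R : 'Z_M) \in H.
      rewrite rmorphB /= (_ : _ - _ = y - x) ?Hsub //.
      by apply/eqP; rewrite subr_eq addrAC -E addrAC subrr add0r.
    rewrite gP => dvd; have cd : c = d.
      by rewrite -[LHS]Ec -[RHS]Ed; apply/eqP; rewrite (eq_intr_Zm g1).
    by move: E; rewrite -cd => /addIr ->.
  rewrite subset_leq_card //; apply/subsetP=> u /imsetP[[c x] cx ->].
  move: cx; rewrite in_setX /= => /andP[cB' xH]; have [rc _] := repP _ cB'.
  by apply: mem_addset => //; apply: mem_resid.
have s1 : (1 < s)%N.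
  rewrite ltnNge; apply/negP=> /card_le1_eqP s1.
  suff E1 : g = 1%N by move: (g1); rewrite E1.
  apply: gcdB => b bB; rewrite -[b]subr0 -(eq_intr_Zm g1).
  by apply/eqP/s1; apply: mem_resid.
have cs : (t.+2 <= s * (N %/ g).+1)%N.
  rewrite -cB -[X in (_ <= _ * X)%N]card_ord /s.
  (* An element of [B] is determined by its residue and its quotient modulo [g]; the quotient is at
     most [N %/ g], so [inord] is faithful. *)
  pose f (b : int) : 'Z_g * 'I_(N %/ g).+1 := (b%:~R, inord `|(b %/ g)%Z|).
  have fB b : b \in B -> (`|(b %/ g)%Z| <= N %/ g)%N.
    by move=> /Bint; case: b => // b; rewrite divz_nat /= lez_nat => h; apply: leq_div2r.
  have -> : #|` B| = size [seq f b | b <- B] by rewrite size_map.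
  rewrite -cardsT -cardsX cardE; apply: uniq_leq_size.
    rewrite map_inj_in_uniq ?fset_uniq // => x y xB yB [/eqP].
    rewrite eq_intr_Zm // => E /(congr1 val); rewrite /= !inordK ?ltnS ?fB // => E'.
    move: (Bint _ xB) (Bint _ yB) E E'.
    case: x {xB} => // a _; case: y {yB} => // b _ E; rewrite !divz_nat /= => E'.
    by rewrite (dvdz_dist_divn E E').
  move=> _ /mapP[b bB ->]; rewrite mem_enum !inE /= andbT.
  by have := mem_resid g bB; rewrite inE.
apply: (span_arith t0 cA N2 big cH s1 h0 (leq_divM _ _) cs).
have le' := leq_trans (leq_add csH (leqnn _)) le.
have sR' : (t.+2 + #|addset (resid M A) (resid M B)| <= #|` A| + 2 * t)%N.
  by rewrite -cB -resid_sumset; apply: leq_trans sR small.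
exact: boundary_arith le' sR' cAM.
Qed.

(** * Translates avoiding a small set *)

Lemma card_img A (f : int -> int) : {in A &, injective f} ->
  #|` [fset f x | x in A]| = #|` A|.
Proof. by move=> fI; rewrite card_in_imfset. Qed.

Lemma card_img_add z A : #|` [fset z + a | a in A]| = #|` A|.
Proof. by apply: card_img => a b _ _ /addrI. Qed.

Lemma card_img_sub z A : #|` [fset z - a | a in A]| = #|` A|.
Proof. by apply: card_img => a b _ _ /addrI/oppr_inj. Qed.

(** * Sums missing from a dense pair *)

Section Holes.
Variables (t N M : nat).

(* [A] and [B] nearly fill the intervals [0, M] and [0, N]. *)
Definition dense_pair A B :=
  [/\ (0 < t)%N, #|` B| = t.+2, (3 * t <= #|` A|)%N, (N <= 2 * t)%N &
      (M + 2 <= #|` A| + t)%N] /\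
  [/\ 0 \in B, N%:Z \in B, {in B, forall b, 0 <= b <= N%:Z} &
      {in A, forall a, 0 <= a <= M%:Z}].

Definition reflect_fset (L : nat) A : {fset int} := [fset L%:Z - a | a in A].

Lemma mem_reflect L A x : (x \in reflect_fset L A) = (L%:Z - x \in A).
Proof.
apply/imfsetP/idP => [[a /= aA ->]|xA]; first by rewrite opprB addrC subrK.
by exists (L%:Z - x) => //=; rewrite opprB addrC subrK.
Qed.

Lemma card_reflect L A : #|` reflect_fset L A| = #|` A|.
Proof. exact: card_img_sub. Qed.

(** Reflection exchanges the two ends of [A + B], so facts about low missing sums transfer to high
    ones. *)
Lemma dense_pair_reflect A B :
  dense_pair A B -> dense_pair (reflect_fset M A) (reflect_fset N B).
Proof.
move=> [[? ? ? ? ?] [B0 BN Bint Aint]]; split; split; rewrite ?card_reflect //.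
- by rewrite mem_reflect subr0.
- by rewrite mem_reflect subrr.
- by move=> b; rewrite mem_reflect => /Bint; lia.
- by move=> a; rewrite mem_reflect => /Aint; lia.
Qed.

Variables (A B : {fset int}).
Hypothesis AB : dense_pair A B.

Let t0 : (0 < t)%N. Proof. by have [[]] := AB. Qed.
Let cB : #|` B| = t.+2. Proof. by have [[]] := AB. Qed.
Let cA : (3 * t <= #|` A|)%N. Proof. by have [[]] := AB. Qed.
Let N2 : (N <= 2 * t)%N. Proof. by have [[]] := AB. Qed.
Let MA : (M + 2 <= #|` A| + t)%N. Proof. by have [[]] := AB. Qed.
Let Bint : {in B, forall b, 0 <= b <= N%:Z}. Proof. by have [_ []] := AB. Qed.
Let Aint : {in A, forall a, 0 <= a <= M%:Z}. Proof. by have [_ []] := AB. Qed.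

Lemma dense_card : (#|` A| <= M.+1)%N /\ (t < N)%N.
Proof.
split; first by apply: (@card_fset_itv _ 0) => a /Aint; lia.
have : (#|` B| <= N.+1)%N by apply: (@card_fset_itv _ 0) => b /Bint; lia.
by rewrite cB.
Qed.

Let MA' : (#|` A| <= M.+1)%N. Proof. by case: dense_card. Qed.
Let tN : (t < N)%N. Proof. by case: dense_card. Qed.

(** For [N <= z <= M], the set [z - B] lies in [0, M] and avoids [A], but [A] has fewer than [t + 2]
    gaps there. *)
Lemma hole_outside z : z \notin sumset A B -> z < N%:Z \/ M%:Z < z.
Proof.
move=> hole; have [?|zN] := ltP z N; first by left.
have [?|zM] := ltP M%:Z z; first by right.
have : (#|` A| + #|` [fset (z - b)%R | b in B]| <= M.+1)%N.
  apply: (@card_fset_itv_disj _ _ 0).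
  - by move=> a /Aint; lia.
  - by move=> _ /imfsetP[b /= /Bint bB ->]; lia.
  - move=> y yA /imfsetP[b /= bB E]; rewrite E in yA.
    by case/negP: hole; rewrite -(subrK b z) mem_sumset.
rewrite card_img_sub cB; lia.
Qed.

(** The right side counts the gaps of [A] in [0, M] plus those of [B] in [0, N]. Each of the [z + 1]
    ways to write [z] as a sum of two natural numbers uses one of these gaps. *)
Lemma low_hole_lt z : z \notin sumset A B -> z < N%:Z ->
  z + 1 <= (M%:Z + 1 - #|` A|%:Z) + (N%:Z - 1 - t%:Z).
Proof.
move=> hole zN; have [zneg|z0] := ltP z 0; first by lia.
have [k Ek] : exists k : nat, z = k by exists `|z|%N; lia.
have cA1 := card_fset_filter A (fun a => a <= z).
have cB1 := card_fset_filter B (fun b => b <= z).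
have a2 : (#|` [fset a in A | ~~ (a <= z)%R]| <= M - k)%N.
  by apply: (@card_fset_itv _ (k + 1)) => a; rewrite !inE => /andP[/= /Aint]; lia.
have b2 : (#|` [fset b in B | ~~ (b <= z)%R]| <= N - k)%N.
  by apply: (@card_fset_itv _ (k + 1)) => a; rewrite !inE => /andP[/= /Bint]; lia.
have : (#|` [fset a in A | (a <= z)%R]| +
        #|` [fset (z - b)%R | b in [fset b in B | (b <= z)%R]]| <= k.+1)%N.
  apply: (@card_fset_itv_disj _ _ 0).
  - by move=> a; rewrite !inE => /andP[/= /Aint]; lia.
  - by move=> _ /imfsetP[b /= + ->]; rewrite !inE => /andP[/= /Bint]; lia.
  - move=> y + /imfsetP[b /= + E]; rewrite E !inE => /andP[/= zbA _] /andP[/= bB _].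
    by case/negP: hole; rewrite -(subrK b z) mem_sumset.
rewrite card_img_sub => le.
have arith (p p' q q' : nat) : (p + p')%N = #|` A| -> (q + q')%N = t.+2 ->
  (p' <= M - k)%N -> (q' <= N - k)%N -> (p + q <= k.+1)%N ->
  z + 1 <= (M%:Z + 1 - #|` A|%:Z) + (N%:Z - 1 - t%:Z) by lia.
by rewrite cB in cB1; apply: arith cA1 cB1 a2 b2 le.
Qed.

End Holes.

Lemma high_hole_gt t N M A B z : dense_pair t N M A B ->
  z \notin sumset A B -> M%:Z < z ->
  M%:Z + N%:Z - z + 1 <= (M%:Z + 1 - #|` A|%:Z) + (N%:Z - 1 - t%:Z).
Proof.
move=> AB hole zM; have := low_hole_lt (dense_pair_reflect AB) (z := M%:Z + N%:Z - z).
rewrite card_reflect; apply; last by lia.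
apply: contra hole => /sumsetP[a [b [+ + E]]]; rewrite !mem_reflect => aA bB.
by rewrite (_ : z = (M%:Z - a) + (N%:Z - b)) ?mem_sumset //; lia.
Qed.

Lemma holes_far_apart t N M A B z z' : dense_pair t N M A B ->
  z \notin sumset A B -> z' \notin sumset A B -> z < N%:Z -> M%:Z < z' ->
  M%:Z < z' - z.
Proof.
move=> AB hole hole' zN zM'.
have low := low_hole_lt AB hole zN; have high := high_hole_gt AB hole' zM'.
have [MA' tN] := dense_card AB.
have [[t0 cB cA N2 MA] [B0 BN Bint Aint]] := AB.
rewrite ltNge; apply/negP=> le.
have sep : z < z' - N%:Z by lia.
pose f b : int := if b <= z then z - b else z' - b.
have : (#|` A| + #|` [fset f b | b in B]| <= M.+1)%N.
  apply: (@card_fset_itv_disj _ _ 0).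
  - by move=> a /Aint; lia.
  - by move=> _ /imfsetP[b /= /Bint bB ->]; rewrite /f; case: ifP; lia.
  - move=> y yA /imfsetP[b /= bB E]; move: yA; rewrite E /f; case: ifP => _ yA.
      by case/negP: hole; rewrite -(subrK b z) mem_sumset.
    by case/negP: hole'; rewrite -(subrK b z') mem_sumset.
rewrite card_img ?cB; first by lia.
move=> b c /Bint hb /Bint hc; rewrite /f; case: ifP; case: ifP; lia.
Qed.

(* The translate [v1 + Bd] supplies [t] elements of [S] below the largest
   element of [v2 + Bd], above which [A + B] has [|A| + t + 1] elements. *)
Lemma two_low_translates t N M A B S Bd (v1 v2 : int) :
  dense_pair t N M A B -> {subset sumset A B <= S} ->
  {subset Bd <= A} -> (t <= #|` Bd|)%N -> v1 < v2 ->
  {in Bd, forall u, v1 + u \in S} -> {in Bd, forall u, v2 + u \notin S} ->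
  {in Bd, forall u, v2 + u < N%:Z} ->
  (#|` A| + 2 * t < #|` S|)%N.
Proof.
move=> AB ABS BdA cBd v12 good bad low.
have [MA' tN] := dense_card AB.
have [[t0 cB cA N2 MA] [B0 BN Bint Aint]] := AB.
have [|u uBd umax] := @fset_max Bd; first by rewrite -cardfs_gt0; lia.
pose z := v2 + u; have zN : z < N%:Z by apply: low.
have hole : z \notin sumset A B by apply: contra (bad _ uBd) => /ABS.
have zle := low_hole_lt AB hole zN.
pose A2 := [fset a in A | ~~ (a <= z)].
have cA2 := card_fset_filter A (fun a => a <= z); rewrite -/A2 in cA2.
(* Reflected through [z], the part of [A] up to [z] shares [N + 1] places with [B], so passing to
   [A2] loses at most [N - 1 - t] elements. *)
have cA1 : (#|` [fset a in A | (a <= z)%R]| + #|` B| <= N.+1)%N.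
  rewrite -(card_img_sub z).
  apply: (@card_fset_itv_disj _ _ 0).
  - by move=> _ /imfsetP[a /= + ->]; rewrite !inE => /andP[/= /Aint]; lia.
  - by move=> b /Bint; lia.
  - move=> y /imfsetP[a /= + ->]; rewrite !inE => /andP[/= aA _] bB.
    by case/negP: hole; rewrite -(subrKC a z) mem_sumset.
have N1 : (1 < N)%N by lia.
have full : resid N (sumset A2 B) = setT.
  apply/eqP; rewrite -subTset; apply/subsetP=> c _; have [x Ex] := Zm_intr c.
  (* The window of length [N] from [y = max(z + 1, 0)] lies in [0, M]. If the class of [x] were
     missed, the residues of [x - b] placed in the window would avoid [A] and give it too many
     gaps. *)
  pose y := Num.max z (-1) + 1.
  have [] := boolP (has (fun a => has (fun b => (N %| x - (a + b))%Z) B) A2).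
    move=> /hasP[a aA /hasP[b bB xab]]; rewrite Ex; apply/residP; exists (a + b).
      exact: mem_sumset.
    by apply/eqP; rewrite eq_intr_Zm.
  move=> /hasPn none.
  have yM : 0 <= y /\ y + N%:Z <= M%:Z + 1 by rewrite /y; lia.
  pose W := [fset a in A | y <= a < y + N%:Z].
  have cW := card_fset_filter A (fun a => y <= a < y + N%:Z); rewrite -/W in cW.
  have : (#|` [fset a in A | ~~ (y <= a < y + N%:Z)%R]| <= M.+1 - N)%N.
    (* Closes up the window by shifting down what lies beyond it. *)
    pose f a : int := if (a < y)%R then a else a - N%:Z.
    have fI : {in [fset a in A | ~~ (y <= a < y + N%:Z)%R] &, injective f}.
      move=> a b; rewrite !inE => /andP[_ ha] /andP[_ hb]; rewrite /f.
      by move: ha hb; case: ifP; case: ifP; lia.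
    rewrite -(card_img fI); apply: (@card_fset_itv _ 0).
    move=> _ /imfsetP[a /= + ->]; rewrite !inE => /andP[/= /Aint hA ha].
    by rewrite /f; move: ha; case: ifP; lia.
  pose g b : int := y + ((x - b - y) %% N)%Z.
  have gP b : y <= g b < y + N%:Z /\ (N %| x - (g b + b))%Z.
    have h0 : 0 <= ((x - b - y) %% N)%Z by rewrite modz_ge0; lia.
    have h1 : ((x - b - y) %% N)%Z < N%:Z by rewrite ltz_pmod; lia.
    split; first by rewrite /g; lia.
    have := divz_eq (x - b - y) N; rewrite /g => E.
    by apply/dvdzP; exists ((x - b - y) %/ N)%Z; lia.
  have : (#|` W| + #|` [fset g b | b in B `\ N%:Z]| <= N)%N.
    apply: (@card_fset_itv_disj _ _ y).
    - by move=> a; rewrite !inE => /andP[].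
    - by move=> _ /imfsetP[b _ ->]; case: (gP b).
    - move=> a + /imfsetP[b /= + E]; rewrite !inE => /andP[/= aA ha] /andP[_ bB].
      have /negP[] : ~~ has (fun b => (N %| x - (a + b))%Z) B.
        by apply: none; rewrite !inE aA /=; move: ha; rewrite /y; lia.
      by apply/hasP; exists b => //; rewrite E; case: (gP b).
  rewrite card_img; last first.
    move=> b d; rewrite !inE => /andP[bN /Bint hb] /andP[dN /Bint hd] E.
    have [_ db] := gP b; have [_ dd] := gP d; rewrite -E in dd.
    have bd : (N %| b - d)%Z.
      rewrite (_ : b - d = (x - (g b + d)) - (x - (g b + b))); last by lia.
      exact: rpredB.
    by apply: (dvdz_dist_small (z := 0) bd); lia.
  have := cardfsD1 N%:Z B; rewrite BN cB add1n => -[<-]; lia.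
have : (#|` A2| + N <= #|` sumset A2 B|)%N.
  have := card_sumset_resid N1 A2 B0 (_ : 0 + N%:Z \in B).
  by rewrite add0r full cardsT card_Zm //; apply.
have : (#|` sumset A2 B| + #|` [fset (v1 + u)%R | u in Bd]| <= #|` S|)%N.
  apply: card_fset_disj.
  - move=> _ /sumsetP[a [b [+ bB ->]]]; rewrite !inE => /andP[/= aA _].
    by apply: ABS; apply: mem_sumset.
  - by move=> _ /imfsetP[w /= wBd ->]; apply: good.
  - move=> y /sumsetP[a [b [+ bB ->]]] /imfsetP[w /= wBd E].
    rewrite !inE => /andP[/= aA az].
    by have := umax _ wBd; have := Bint _ bB; move: az; rewrite /z; lia.
rewrite card_img_add cB in cA1 *.
have arith (a1 a2 ab bd s : nat) : (a1 + a2 = #|` A|)%N -> (a1 + t.+2 <= N.+1)%N ->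
  (t <= bd)%N -> (ab + bd <= s)%N -> (a2 + N <= ab)%N -> (#|` A| + 2 * t < s)%N by lia.
exact: arith cA2 cA1 cBd.
Qed.

(** * Three vertices against a small set of edge sums *)

(* [Bd i] stands for the labels of the non-neighbours of the vertex [v i]. *)
Definition obstruction (t : nat) A B S (v : 'I_3 -> int) (Bd : 'I_3 -> {fset int}) :=
  [/\ {subset sumset A B <= S}, injective v,
      (forall i, {subset Bd i <= A} /\ (t <= #|` Bd i|)%N),
      (forall i, {in Bd i, forall u, v i + u \notin S}) &
      (forall i j, i != j -> {in Bd j, forall u, v i + u \in S})].

(** The span bounds make the pair dense, so each index is low or high. Two of the three indices
    agree, and [two_low_translates] contradicts this, directly or after reflection. *)
Lemma card_lt_normalized t A B S v Bd (M N : nat) :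
  obstruction t A B S v Bd -> (0 < t)%N -> #|` B| = t.+2 -> (3 * t <= #|` A|)%N ->
  0 \in A -> M%:Z \in A -> {in A, forall a, 0 <= a <= M%:Z} ->
  0 \in B -> N%:Z \in B -> {in B, forall b, 0 <= b <= N%:Z} ->
  (forall g : nat, {in B, forall b, (g %| b)%Z} -> g = 1%N) ->
  (#|` A| + 2 * t < #|` S|)%N.
Proof.
move=> [ABS v_inj BdA bad good] t0 cB cA A0 AM Aint B0 BN Bint gcdB.
rewrite ltnNge; apply/negP=> small.
have small' : (#|` sumset A B| <= #|` A| + 2 * t)%N.
  by apply: leq_trans small; apply: card_fset_sub.
have N2 : (N <= 2 * t)%N.
  by have := leq_trans (span_le t0 cB cA B0 BN Bint gcdB small') small'; rewrite leq_add2l.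
have MA := length_le t0 cB cA N2 A0 AM Aint B0 Bint gcdB small'.
have AB : dense_pair t N M A B by [].
have hole i u : u \in Bd i -> v i + u \notin sumset A B.
  by move=> uB; apply: contra (bad _ _ uB) => /ABS.
pose low i := all (fun u => v i + u < N%:Z) (Bd i).
have lowP i : low i -> {in Bd i, forall u, v i + u < N%:Z} by move=> /allP.
have highP i : ~~ low i -> {in Bd i, forall u, M%:Z < v i + u}.
  move=> /allPn[w wB]; rewrite -leNgt => hw u uB.
  have {hw} hw : M%:Z < v i + w by case: (hole_outside AB (hole _ _ wB)) => //; lia.
  case: (hole_outside AB (hole _ _ uB)) => // lu.
  have := holes_far_apart AB (hole _ _ uB) (hole _ _ wB) lu hw.
  by have := Aint _ ((BdA i).1 _ wB); have := Aint _ ((BdA i).1 _ uB); lia.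
have clash i j : i != j -> low i = low j -> v i < v j -> False.
  move=> ij lij vij; have [li|hi] := boolP (low i).
    have : (#|` A| + 2 * t < #|` S|)%N; last by rewrite ltnNge small.
    apply: (@two_low_translates t N M A B S (Bd j) (v i) (v j)) => //.
    - exact: (BdA j).1.
    - exact: (BdA j).2.
    - exact: good.
    - by apply: lowP; rewrite -lij.
  suff : (#|` A| + 2 * t < #|` S|)%N by rewrite ltnNge small.
  (* On the high side, [v] becomes [N - v], which reverses the order, so [i] and [j] exchange
     roles. *)
  have := @two_low_translates t N M (reflect_fset M A) (reflect_fset N B)
    (reflect_fset (M + N) S) (reflect_fset M (Bd i)) (N%:Z - v j) (N%:Z - v i)
    (dense_pair_reflect AB).
  rewrite !card_reflect.
  have flip w u : N%:Z - w + u = (M + N)%N%:Z - (w + (M%:Z - u)) by lia.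
  apply=> //.
  - move=> z /sumsetP[a [b [aA bB ->]]]; rewrite mem_reflect.
    rewrite (_ : _ - _ = (M%:Z - a) + (N%:Z - b)); last by lia.
    by apply/ABS/mem_sumset; rewrite -mem_reflect.
  - by move=> a; rewrite !mem_reflect; apply: (BdA i).1.
  - exact: (BdA i).2.
  - by lia.
  - move=> u; rewrite !mem_reflect => uB; rewrite flip subKr.
    by apply: good uB; rewrite eq_sym.
  - by move=> u; rewrite !mem_reflect => uB; rewrite flip subKr; apply: bad.
  - by move=> u; rewrite mem_reflect => /(highP _ hi); lia.
have clash' i j : i != j -> low i = low j -> False.
  move=> ij lij; case: (ltgtP (v i) (v j)) => [|lt|/v_inj E]; first exact: clash.
    by apply: clash lt; rewrite // eq_sym.
  by rewrite E eqxx in ij.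
case E0: (low ord0); case E1: (low (lift ord0 ord0)); case E2: (low ord_max);
  by [apply: (@clash' ord0 (lift ord0 ord0)); rewrite // E0 E1
     |apply: (@clash' ord0 ord_max); rewrite // E0 E2
     |apply: (@clash' (lift ord0 ord0) ord_max); rewrite // E1 E2].
Qed.

(** * Normalization by translation and division *)

Lemma fset_min A : A != fset0 -> exists2 x, x \in A & {in A, forall y, x <= y}.
Proof.
move=> A0; have [|x] := @fset_max (reflect_fset 0 A).
  by rewrite -cardfs_gt0 card_reflect cardfs_gt0.
rewrite mem_reflect => xA xmax; exists (0%N%:Z - x) => // y yA.
have := xmax (0%N%:Z - y); rewrite mem_reflect => h.
have : 0%N%:Z - y <= x; last by lia.
by apply: h; rewrite (_ : _ - _ = y) //; lia.
Qed.

Lemma fset_gcd B b : b \in B -> b != 0 -> exists d : nat,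
  [/\ (0 < d)%N, {in B, forall b, (d %| b)%Z} &
      forall g : nat, {in B, forall b, (g %| b)%Z} -> (g %| d)%N].
Proof.
move=> bB b0; exists (\big[gcdn/0%N]_(x <- B) `|x|%N).
have dv x : x \in B -> (\big[gcdn/0%N]_(x <- B) `|x|%N %| `|x|)%N.
  by move=> xB; rewrite (big_rem x xB) /= dvdn_gcdl.
split=> [|x xB|g gB]; first 1 last.
- exact: dv.
- rewrite big_seq; elim/big_rec: _ => [|x y xB gy]; first exact: dvdn0.
  by rewrite dvdn_gcd gy andbT; have := gB _ xB; rewrite dvdzE.
- have := dv _ bB; case: posnP => // ->; rewrite dvd0n absz_eq0; by rewrite (negbTE b0).
Qed.

(* A largest element of a residue class of [A] modulo a common divisor of [B],
   added to the positive elements of [B], leaves [A]. *)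
Lemma card_sumset_two_classes A B (d : nat) a1 a2 : 0 \in B ->
  {in B, forall b, 0 <= b /\ (d %| b)%Z} -> a1 \in A -> a2 \in A ->
  ~~ (d %| a1 - a2)%Z -> (#|` A| + 2 * #|` B| <= #|` sumset A B| + 2)%N.
Proof.
move=> B0 Bd a1A a2A a12.
have [x1 /class_maxP[x1A x1m] d1] := class_max_ex d a1A.
have [x2 /class_maxP[x2A x2m] d2] := class_max_ex d a2A.
have x12 : ~~ (d %| x1 - x2)%Z.
  apply: contra a12 => h.
  rewrite (_ : a1 - a2 = (a1 - x1) + (x1 - x2) - (a2 - x2)); last by lia.
  by apply: rpredB => //; apply: rpredD.
pose T x := [fset x + b | b in B `\ 0].
have new x : x \in A -> {in A, forall y, (d %| x - y)%Z -> y <= x} ->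
    forall y, y \in T x -> y \in A -> False.
  move=> xA xm y /imfsetP[b /= + ->] yA; rewrite !inE => /andP[b0 bB].
  have [b1 db] := Bd _ bB; have := xm _ yA.
  by rewrite opprD addNKr dvdzE abszN -dvdzE => /(_ db); lia.
have sub x : x \in A -> {subset T x <= sumset A B}.
  move=> xA y /imfsetP[b /= + ->]; rewrite !inE => /andP[_ bB].
  exact: mem_sumset.
have AS : {subset A <= sumset A B}.
  by move=> a aA; rewrite -[a]addr0; apply: mem_sumset.
have cT x : (#|` T x| + 1 = #|` B|)%N.
  by rewrite card_img_add addn1 (cardfsD1 0 B) B0 add1n.
have c2 : (#|` T x1 `|` T x2| = #|` T x1| + #|` T x2|)%N.
  rewrite -cardfsUI (_ : T x1 `&` T x2 = fset0) ?cardfs0 ?addn0 //.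
  apply/fsetP=> y; rewrite in_fset0 in_fsetI; apply/negP.
  move=> /andP[/imfsetP[b /= + ->] /imfsetP[c /= +]].
  rewrite !inE => /andP[_ bB] /andP[_ cB] E; case/negP: x12.
  rewrite (_ : x1 - x2 = c - b); last by lia.
  by apply: rpredB; [case: (Bd _ cB)|case: (Bd _ bB)].
have : (#|` A| + #|` T x1 `|` T x2| <= #|` sumset A B|)%N.
  apply: card_fset_disj => // [y|y yA]; rewrite in_fsetU => /orP[].
  - exact: sub.
  - exact: sub.
  - by move=> /new; apply.
  - by move=> /new; apply.
rewrite c2; have := cT x1; have := cT x2; lia.
Qed.

(** The translate of [B] by the maximum of [A] meets [A] only in that maximum. *)
Lemma card_sumset_ge A B : A != fset0 -> 0 \in B -> {in B, forall b, 0 <= b} ->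
  (#|` A| + #|` B| <= #|` sumset A B| + 1)%N.
Proof.
move=> A0 B0 Bpos; have [x xA xm] := fset_max A0.
have cT : (#|` [fset (x + b)%R | b in B `\ 0%R]| + 1 = #|` B|)%N.
  by rewrite card_img_add addn1 (cardfsD1 0 B) B0 add1n.
rewrite -cT addnA leq_add2r; apply: card_fset_disj.
- by move=> a aA; rewrite -[a]addr0; apply: mem_sumset.
- move=> y /imfsetP[b /= + ->]; rewrite !inE => /andP[_ bB].
  exact: mem_sumset.
- move=> y yA /imfsetP[b /= + E]; rewrite !inE => /andP[b0 bB].
  by have := xm _ yA; have := Bpos _ bB; lia.
Qed.

(** An affine change of variable on the class of [x] modulo [d]. Dropping the other classes lets it
    apply to [S] too, whose size can then only decrease. *)
Definition rescale (d : nat) x A : {fset int} :=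
  [fset ((a - x) %/ d)%Z | a in [fset a in A | (d %| a - x)%Z]].

Lemma mem_rescale (d : nat) x A y : (0 < d)%N ->
  (y \in rescale d x A) = (y * d%:Z + x \in A).
Proof.
move=> d0; apply/imfsetP/idP => [[a /= + ->]|yA].
  by rewrite !inE => /andP[/= aA dv]; rewrite divzK // subrK.
exists (y * d%:Z + x); rewrite /= ?inE ?addrK /= ?yA ?dvdz_mull //.
by rewrite mulzK //; lia.
Qed.

Lemma card_rescale (d : nat) x A : (0 < d)%N ->
  #|` rescale d x A| = #|` [fset a in A | (d %| a - x)%Z]|.
Proof.
move=> d0; apply: card_img => a b; rewrite !inE => /andP[_ da] /andP[_ db] E.
by apply: (addIr (- x)); rewrite -(divzK da) E divzK.
Qed.

Lemma card_rescale_full (d : nat) x A : (0 < d)%N ->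
  {in A, forall a, (d %| a - x)%Z} -> #|` rescale d x A| = #|` A|.
Proof.
move=> d0 dA; rewrite card_rescale //; congr #|` _|; apply/fsetP=> a.
by rewrite !inE /=; case aA: (a \in A) => //=; apply: dA.
Qed.

Lemma card_rescale_le (d : nat) x A : (0 < d)%N -> (#|` rescale d x A| <= #|` A|)%N.
Proof.
by move=> d0; rewrite card_rescale //; apply: card_fset_sub => a; rewrite !inE => /andP[].
Qed.

(** The sets [Bd i] are pairwise disjoint, whence [3t <= |A|]. Moving both minima to 0 and dividing
    by the gcd [d] of the translated [B] leads to [card_lt_normalized], once [A] and the [v i] are
    known to lie in single classes modulo [d]. *)
Lemma card_lt_obstruction t A B S v Bd :
  obstruction t A B S v Bd -> (0 < t)%N -> #|` B| = t.+2 ->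
  (#|` A| + 2 * t < #|` S|)%N.
Proof.
move=> ob t0 cB; have [ABS v_inj BdA bad good] := ob.
have BdI i j u : i != j -> u \in Bd i -> u \in Bd j -> False.
  by move=> ij ui /(good _ _ ij); rewrite (negbTE (bad _ _ ui)).
have cBd2 i j : i != j -> (2 * t <= #|` Bd i `|` Bd j|)%N.
  move=> ij; apply: leq_trans (_ : #|` Bd i| + #|` Bd j| <= _)%N.
    by have := (BdA i).2; have := (BdA j).2; lia.
  apply: card_fset_disj; last by move=> u; apply: BdI.
    by move=> u ui; rewrite in_fsetU ui.
  by move=> u uj; rewrite in_fsetU uj orbT.
have cA : (3 * t <= #|` A|)%N.
  pose i0 : 'I_3 := ord0; pose i1 : 'I_3 := lift ord0 ord0; pose i2 : 'I_3 := ord_max.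
  apply: leq_trans (_ : #|` Bd i0 `|` Bd i1| + #|` Bd i2| <= _)%N.
    by have := cBd2 i0 i1 isT; have := (BdA i2).2; lia.
  apply: card_fset_disj.
  - by move=> u; rewrite in_fsetU => /orP[]; apply: (BdA _).1.
  - exact: (BdA _).1.
  - move=> u; rewrite in_fsetU => /orP[u0|u1] u2.
      exact: (@BdI i0 i2 u).
    exact: (@BdI i1 i2 u).
rewrite ltnNge; apply/negP=> small.
have [|a0 a0A a0min] := @fset_min A; first by rewrite -cardfs_gt0; lia.
have [|b0 b0B b0min] := @fset_min B; first by rewrite -cardfs_gt0 cB.
pose B0 := rescale 1 b0 B.
have mB0 b : (b \in B0) = (b + b0 \in B) by rewrite mem_rescale // mulr1.
have B00 : 0 \in B0 by rewrite mB0 add0r.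
have cB0 : #|` B0| = t.+2.
  by rewrite card_rescale_full // => b _; rewrite dvdzE dvd1n.
have [b1 b1B b1n0] : exists2 b, b \in B0 & b != 0.
  have /fset0Pn[b] : B0 `\ 0 != fset0.
    by rewrite -cardfs_gt0; have := cardfsD1 0 B0; rewrite B00 cB0 add1n => -[<-].
  by rewrite !inE => /andP[? ?]; exists b.
have [d [d0 dB gcdB]] := fset_gcd b1B b1n0.
have B0pos : {in B0, forall b, 0 <= b} by move=> b; rewrite mB0 => /b0min; lia.
have cS0 : #|` sumset A B0| = #|` sumset A B|.
  rewrite -(card_img_add b0); congr #|` _|; apply/fsetP=> z; apply/imfsetP/sumsetP.
    move=> [_ /= /sumsetP[a [b [aA + ->]]] ->]; rewrite mB0 => bB.
    by exists a, (b + b0); split=> //; lia.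
  move=> [a [b [aA bB ->]]]; exists (a + (b - b0)); last by lia.
  by apply: mem_sumset; rewrite // mB0 subrK.
have cAB : (#|` sumset A B| <= #|` S|)%N by apply: card_fset_sub.
(* Two classes in [A] would give [|A + B| >= |A| + 2(t + 2) - 2]. *)
have dA a : a \in A -> (d %| a - a0)%Z.
  move=> aA; apply: contraTT small => nd; rewrite -ltnNge.
  have dB' : {in B0, forall b, 0 <= b /\ (d %| b)%Z}.
    by move=> b bB; split; [apply: B0pos|apply: dB].
  have := card_sumset_two_classes B00 dB' aA a0A nd; rewrite cS0 cB0; lia.
(* In another class, [v i] plus the other two sets [Bd] would add [2t] edge sums to the at least
   [|A| + t + 1] of [A + B]. *)
have dv i : (d %| v i - b0)%Z.
  apply: contraTT small => nd; rewrite -ltnNge.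
  have [j [l [ij il jl]]] : exists j l : 'I_3, [/\ i != j, i != l & j != l].
    by case: i {nd} => -[|[|[|//]]] ?; [exists (lift ord0 ord0), ord_max
      |exists ord0, ord_max|exists ord0, (lift ord0 ord0)].
  have cU : (#|` sumset A B| + #|` [fset (v i + u)%R | u in Bd j `|` Bd l]| <= #|` S|)%N.
    apply: card_fset_disj => //.
      by move=> _ /imfsetP[u /= + ->]; rewrite in_fsetU => /orP[]; apply: good.
    move=> _ /sumsetP[a [b [aA bB ->]]] /imfsetP[u /= uU E]; case/negP: nd.
    have uA : u \in A by move: uU; rewrite in_fsetU => /orP[]; apply: (BdA _).1.
    have db : (d %| b - b0)%Z by apply: dB; rewrite mB0 subrK.
    rewrite (_ : v i - b0 = (a - a0) + (b - b0) - (u - a0)); last by lia.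
    by apply: rpredB (dA _ uA); apply: rpredD db; apply: dA.
  rewrite card_img_add in cU.
  have := cBd2 _ _ jl; have A0 : A != fset0 by rewrite -cardfs_gt0; lia.
  have := card_sumset_ge A0 B00 B0pos; rewrite cS0 cB0; move: cU; lia.
pose A' := rescale d a0 A; pose B' := rescale d b0 B; pose S' := rescale d (a0 + b0) S.
pose v' i := ((v i - b0) %/ d)%Z; pose Bd' i := rescale d a0 (Bd i).
have vE i : v i = v' i * d%:Z + b0 by rewrite divzK // subrK.
have dB1 : {in B, forall b, (d %| b - b0)%Z} by move=> b bB; apply: dB; rewrite mB0 subrK.
have cA' : #|` A'| = #|` A| by apply: card_rescale_full.
have cB' : #|` B'| = t.+2 by rewrite card_rescale_full.
have dpos : 0 < d%:Z by lia.
have ob' : obstruction t A' B' S' v' Bd'.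
  split.
  - move=> _ /sumsetP[a [b [+ + ->]]]; rewrite !mem_rescale // => aA bB.
    by rewrite mulrDl addrACA; apply/ABS/mem_sumset.
  - by move=> i j E; apply: v_inj; rewrite !vE E.
  - move=> i; split; first by move=> u; rewrite !mem_rescale //; apply: (BdA i).1.
    rewrite card_rescale_full //; first exact: (BdA i).2.
    by move=> u /(BdA i).1; apply: dA.
  - move=> i u; rewrite !mem_rescale // => uB.
    by rewrite mulrDl [a0 + _]addrC addrACA -vE; apply: bad.
  - move=> i j ij u; rewrite !mem_rescale // => uB.
    by rewrite mulrDl [a0 + _]addrC addrACA -vE; apply: good uB.
have A'pos : {in A', forall a, 0 <= a} by move=> a; rewrite mem_rescale // => /a0min; nia.
have B'pos : {in B', forall b, 0 <= b} by move=> b; rewrite mem_rescale // => /b0min; nia.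
have A'0 : 0 \in A' by rewrite mem_rescale // mul0r add0r.
have B'0 : 0 \in B' by rewrite mem_rescale // mul0r add0r.
have [|M MA Mmax] := @fset_max A'; first by apply/fset0Pn; exists 0.
have [|N NB Nmax] := @fset_max B'; first by apply/fset0Pn; exists 0.
have M0 := A'pos _ MA; have N0 := B'pos _ NB.
have := @card_lt_normalized t A' B' S' v' Bd' `|M|%N `|N|%N ob' t0 cB'.
rewrite cA' !gez0_abs // => h.
have := leq_trans (h _ _ _ _ _ _ _ _) (card_rescale_le _ _ d0).
rewrite ltnNge small => {}h; have // : false; apply: h => //.
- by move=> a aA; rewrite A'pos ?Mmax.
- by move=> b bB; rewrite B'pos ?Nmax.
(* If [g] divides all of [B'], then [g * d] divides all of [B0], hence divides [d]. *)
- move=> g gB; have : (g * d %| d)%N.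
    apply: gcdB => b bB; have bB' : (b %/ d)%Z \in B'.
      by rewrite mem_rescale // divzK ?dB // -mB0.
    by rewrite -(divzK (dB _ bB)) PoszM dvdz_mul // gB.
  by rewrite -{2}[d]mul1n dvdn_pmul2r // dvdn1 => /eqP.
Qed.

End IntegerSumsets.

(** * The graph *)

Lemma sum_index_le (G : sgraph) (f : G -> int) (s : seq int) :
  injective f -> (forall x y, adj x y -> (f x + f y)%R \in s) -> sum_index G <= size s.
Proof.
move=> f_inj fs; rewrite /sum_index; case: ex_minnP => m _ minm.
apply: leq_trans (minm (nb_edge_sums f) _) _; first by apply/asboolP; exists f.
apply: uniq_leq_size; first exact: undup_uniq.
move=> z; rewrite mem_undup => /mapP[[x y] xy ->].
by apply: fs; move: xy; rewrite mem_enum.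
Qed.

Lemma exclusive_sum_number_ge (G : sgraph) m :
  (forall r, exclusive_achievable G r -> m <= r) -> m <= exclusive_sum_number G.
Proof.
by move=> h; rewrite /exclusive_sum_number; case: ex_minnP => r /asboolP /h.
Qed.

(** Serves to put two chosen vertices at the ends of [U]. One transposition sends [x] to 0; a second
    one, fixing 0, sends the image of [y] to the end. *)
Lemma perm_first_last n (x y : 'I_n) : x != y ->
  exists p : {perm 'I_n}, p x = 0 :> nat /\ p y = n.-1 :> nat.
Proof.
case: n x y => [[]//|n] x y xy.
have n0 : (ord_max : 'I_n.+1) != ord0.
  apply: contraNneq xy => /(congr1 val) /= n0; apply/eqP/ord_inj.
  by have := ltn_ord x; have := ltn_ord y; lia.
have w0 : tperm x ord0 y != ord0.
  by rewrite -[X in _ != X](tpermL x ord0) (inj_eq perm_inj) eq_sym.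
exists (tperm x ord0 * tperm (tperm x ord0 y) ord_max)%g; rewrite !permM tpermL.
by move: (tperm x ord0 y) w0 => w w0; rewrite tpermL tpermD.
Qed.

(** * The labelling for the upper bound and the reduction for the lower bound *)

Section Bounds.
Variables (n k : nat) (N : 'I_3 -> {set 'I_n}).
Hypotheses (hk : 3 <= k) (hn : 3 * k - 6 <= n).
Hypothesis hN : forall i : 'I_3, #|N i| = n - k + 2.
Hypothesis hdisj : forall i j : 'I_3, i != j -> [disjoint ~: N i & ~: N j].

Let cNC i : #|~: N i| = k - 2.
Proof. by have := cardsC (N i); rewrite hN card_ord; lia. Qed.

(* The two ends of [U], labelled 0 and [n - 1], are non-neighbours of the vertices
   labelled [c - 2] and [c + k], so all edge sums lie between [c - 1] and
   [c + n + k - 2]. *)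
Lemma sum_index_Gnk : sum_index (Gnk k N) <= n + k.
Proof.
pose i1 : 'I_3 := lift ord0 ord0.
have [u1 u1N] : exists u, u \in ~: N i1 by apply/set0Pn; rewrite -card_gt0 cNC; lia.
have [u2 u2N] : exists u, u \in ~: N ord_max by apply/set0Pn; rewrite -card_gt0 cNC; lia.
have u12 : u1 != u2.
  by apply: contraTneq u1N => ->; rewrite (disjointFl (@hdisj i1 ord_max isT) u2N).
have [p [p1 p2]] := perm_first_last u12.
(* With this [c] the labels are 0, ..., [n + k + 2]: first [U], then [c - 2] and [c - 1], then [W],
   then [c + k]. *)
pose c : int := n%:Z + 2.
pose f (x : Gnk k N) : int := match x with
  | inl (inl u) => (p u)%:Z
  | inl (inr w) => c + w%:Z
  | inr i => nth 0 [:: c - 1; c - 2; c + k%:Z] i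
  end%R.
have fE (i : 'I_3) : [\/ i = ord0 /\ f (inr i) = (c - 1)%R,
    i = i1 /\ f (inr i) = (c - 2)%R | i = ord_max /\ f (inr i) = (c + k%:Z)%R].
  by case: i => -[|[|[|//]]] h; [apply: Or31|apply: Or32|apply: Or33];
    split=> //; apply: val_inj.
pose s : seq int := [seq (c - 1 + j%:Z)%R | j <- iota 0 (n + k)].
have <- : size s = n + k by rewrite size_map size_iota.
have inS z : (c - 1 <= z)%R -> (z <= c + n%:Z + k%:Z - 2)%R -> z \in s.
  move=> h1 h2; apply/mapP; exists `|(z - (c - 1))%R|%N; first by rewrite mem_iota; lia.
  by lia.
apply: (@sum_index_le _ f).
  move=> [[u|w]|i] [[u'|w']|j] /=.
  - by move=> /eqP; rewrite eqz_nat => /eqP/val_inj/perm_inj ->.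
  - by have := ltn_ord (p u); rewrite /c; lia.
  - by have := ltn_ord (p u); case: (fE j) => -[_ /= ->]; rewrite /c; lia.
  - by have := ltn_ord (p u'); rewrite /c; lia.
  - by move=> E; congr (inl (inr _)); apply: val_inj => /=; lia.
  - by have := ltn_ord w; case: (fE j) => -[_ /= ->]; rewrite /c; lia.
  - by have := ltn_ord (p u'); case: (fE i) => -[_ /= ->]; rewrite /c; lia.
  - by have := ltn_ord w'; case: (fE i) => -[_ /= ->]; rewrite /c; lia.
  - move=> E0; have E : f (inr i) = f (inr j) := E0.
    by case: (fE i) => -[Ei Fi]; case: (fE j) => -[Ej Fj]; rewrite ?Ei ?Ej //;
      rewrite Fi Fj in E; lia.
have uv u i : u \in N i -> (f (inl (inl u)) + f (inr i))%R \in s.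
  move=> uN; have pu := ltn_ord (p u); apply: inS; case: (fE i) => -[Ei ->] /=; try lia.
    rewrite Ei in uN; have : (p u : nat) <> 0; last by lia.
    rewrite -p1 => /val_inj/perm_inj E; move: u1N; by rewrite inE -E uN.
  rewrite Ei in uN; have : (p u : nat) <> n.-1; last by lia.
  rewrite -p2 => /val_inj/perm_inj E; move: u2N; by rewrite inE -E uN.
have uw u w : (f (inl (inl u)) + f (inl (inr w)))%R \in s.
  by have := ltn_ord (p u); have := ltn_ord w => /=; move=> *; apply: inS; lia.
move=> [[u|w]|i] [[u'|w']|j] //= adj; first exact: uw.
- exact: uv.
- by rewrite addrC; apply: uw.
- by rewrite addrC; apply: uv.
Qed.

(** The labels of the added vertices contain every edge sum and no sum over a non-adjacent pair of
    distinct vertices. With [t = k - 2], and the labels of [U] and [W] as summands, this is an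
    obstruction. *)
Lemma exclusive_sum_number_Gnk : n + 2 * k - 3 <= exclusive_sum_number (Gnk k N).
Proof.
apply: exclusive_sum_number_ge => r [f [[f_inj f_pos f_adj] f_excl]].
pose emb (x : Gnk k N) : dunion (Gnk k N) (edgeless r) := inl x.
pose g (x : Gnk k N) : int := Posz (f (emb x)).
have g_inj : injective g by move=> x y [] /f_inj [].
pose fs (T : finType) (P : {set T}) (h : T -> int) : {fset int} := [fset h x | x in P]%fset.
have cfs (T : finType) (P : {set T}) (h : T -> int) :
    injective h -> #|` fs T P h|%fset = #|P|.
  by move=> h_inj; rewrite card_imfset //= cardE.
have fsP (T : finType) (P : {set T}) (h : T -> int) z :
    reflect (exists2 x, x \in P & z = h x) (z \in fs T P h).
  by apply: (iffP idP) => [/imfsetP[x /= xP ->]|[x xP ->]]; [exists x|apply: in_imfset].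
pose gu (u : 'I_n) := g (inl (inl u)); pose gw (w : 'I_k) := g (inl (inr w)).
pose S := fs _ [set: 'I_r] (fun i => Posz (f (inr i))).
have gu_inj : injective gu by move=> u u' /g_inj [].
have gw_inj : injective gw by move=> w w' /g_inj [].
have cS : #|` S|%fset = r by rewrite cfs ?cardsT ?card_ord // => i j [] /f_inj [].
(* An edge sum is the label of a working vertex, hence of an added one. *)
have adjS x y : adj x y -> (g x + g y)%R \in S.
  move=> xy; have xny : emb x != emb y.
    by apply: contraTneq xy => -[->]; rewrite adj_irrefl.
  have [+ _] := f_adj _ _ xny; case=> // -[z|i] E.
    by case: (f_excl z); exists (emb x), (emb y).
  by apply/fsP; exists i => //; exact: (congr1 Posz E).
have nadjS x y : x != y -> ~~ adj x y -> (g x + g y)%R \notin S.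
  move=> xy; apply: contra => /fsP[i _ [E]].
  have xny : emb x != emb y by apply: contra xy => /eqP[->].
  by apply: (f_adj _ _ xny).2; exists (inr i).
have core := @card_lt_obstruction (k - 2) (fs _ [set: 'I_n] gu) (fs _ [set: 'I_k] gw) S
  (fun i => g (inr i)) (fun i => fs _ (~: N i) gu).
rewrite cS !cfs ?cardsT ?card_ord // in core.
have // : n + 2 * (k - 2) < r; last by lia.
apply: core; try lia; split.
- move=> _ /sumsetP[_ [_ [/fsP[u _ ->] /fsP[w _ ->] ->]]].
  exact: adjS.
- by move=> i j /g_inj [].
- move=> i; split; last by rewrite cfs // cNC.
  by move=> _ /fsP[u _ ->]; apply/fsP; exists u; rewrite ?inE.
- move=> i _ /fsP[u + ->]; rewrite inE => uN.
  exact: nadjS.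
- move=> i j ij _ /fsP[u uN ->]; apply: adjS => /=.
  by have := disjointFl (hdisj ij) uN; rewrite inE => /negbFE.
Qed.

End Bounds.

Unset Implicit Arguments.

Theorem theorem4p2 (n k : nat) (hk : 3 <= k) (hn : 3 * k - 6 <= n)
  (N : 'I_3 -> {set 'I_n})
  (hN : forall i : 'I_3, #|N i| = n - k + 2)
  (hdisj : forall i j : 'I_3, i != j -> [disjoint ~: N i & ~: N j]) :
  sum_index (Gnk k N) <= n + k /\
  n + 2 * k - 3 <= exclusive_sum_number (Gnk k N).
Proof.
by split; [apply: sum_index_Gnk|apply: exclusive_sum_number_Gnk].
Qed.
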